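(* Let $\mathbb K$ be a field of characteristic $0$, let $\ell\ge 2$, and let $\mathcal{MR}$ be the multiple Riordan group of all $\ell$-multiple Riordan arrays $(g;f_1,\ldots,f_\ell)$ over $\mathbb K$. Then each of the following subsets is a subgroup of $\mathcal{MR}$: (1) (Appell) $\mathcal A=\{(g;t,\ldots,t)\in\mathcal{MR}\}$, with $g$ arbitrary; (2) (Lagrange) $\mathcal L=\{(1;f_1,\ldots,f_\ell)\in\mathcal{MR}\}$, with $f_1,\ldots,f_\ell$ arbitrary; (3) (derivative) $\mathcal D=\{(h'(t);f_1,\ldots,f_\ell)\in\mathcal{MR}\}$, where $h=\sqrt[\ell]{f_1f_2\cdots f_\ell}$, i.e. the set of all $(g;f_1,\ldots,f_\ell)\in\mathcal{MR}$ for which there is $h\in t\,\mathbb K[[t^\ell]]$ with $h^\ell=f_1\cdots f_\ell$ and $g=h'$ (formal derivative); (4) ($j$-th Bell) for each $j\in\{1,\ldots,\ell\}$, $\mathcal B_j=\{(g;f_1,\ldots,f_\ell)\in\mathcal{MR}: f_j=t\,g\}$.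
   Context: $\ell$-multiple Riordan arrays: tuples $(g;f_1,\ldots,f_\ell)$ with $g\in\mathbb K[[t^\ell]]$, $g(0)\ne 0$, and $f_i\in t\,\mathbb K[[t^\ell]]$ with $[t]f_i\neq 0$ for $i=1,\ldots,\ell$. (Such a tuple corresponds to the infinite lower triangular matrix whose successive columns have generating functions $g, gf_1, gf_1f_2,\ldots, gf_1\cdots f_\ell, gf_1^2f_2\cdots f_\ell,\ldots$.) The set $\mathcal{MR}$ of all of them is a group, the multiple Riordan group, under $$(g;f_1,\ldots,f_\ell)(d;h_1,\ldots,h_\ell)=\Big(g\,d(h);\ \tfrac{f_1}{h}h_1(h),\ \ldots,\ \tfrac{f_\ell}{h}h_\ell(h)\Big),\qquad h=\sqrt[\ell]{f_1f_2\cdots f_\ell}.$$ Here $h$ is any formal power series with $h^\ell=f_1\cdots f_\ell$, over the algebraic closure of $\mathbb K$ if necessary; since $d(h)$ and $h_i(h)/h$ are power series in $h^\ell$, the product has coefficients in $\mathbb K$ and does not depend on the choice of $h$. The identity is $(1;t,\ldots,t)$. *)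

(* Defs.v *)
From HB Require Import structures.
From mathcomp Require Import all_boot all_algebra all_field.
From mathcomp Require Import boolp ring.

Set Implicit Arguments.
Unset Strict Implicit.
Unset Printing Implicit Defensive.

Import GRing.Theory.
Local Open Scope ring_scope.

(* Formal power series in one variable t. They are wrapped in a record because
   mathcomp-classical gives nat -> R the pointwise multiplication. *)
Record fps (R : Type) := FPS { fps_coef :> nat -> R }.

Lemma fpsP (R : Type) (a b : fps R) : (forall n, a n = b n) <-> a = b.
Proof.
split=> [|-> //]; case: a b => [a] [b] /= eq_ab.
by congr FPS; apply/funext.
Qed.

HB.instance Definition _ (R : Type) := gen_eqMixin (fps R).
HB.instance Definition _ (R : Type) := gen_choiceMixin (fps R).

Section FpsRing.

Variable R : comNzRingType.
Implicit Types (a b c : fps R) (n : nat).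

Definition fps_zero : fps R := FPS (fun=> 0).
Definition fps_opp a := FPS (fun n => - a n).
Definition fps_add a b := FPS (fun n => a n + b n).
Definition fps_one : fps R := FPS (fun n => (n == 0%N)%:R).
Definition fps_mul a b := FPS (fun n => \sum_(i < n.+1) a i * b (n - i)%N).

Fact fps_addA : associative fps_add.
Proof. by move=> a b c; apply/fpsP => n /=; rewrite addrA. Qed.
Fact fps_addC : commutative fps_add.
Proof. by move=> a b; apply/fpsP => n /=; rewrite addrC. Qed.
Fact fps_add0 : left_id fps_zero fps_add.
Proof. by move=> a; apply/fpsP => n /=; rewrite add0r. Qed.
Fact fps_addN : left_inverse fps_zero fps_opp fps_add.
Proof. by move=> a; apply/fpsP => n /=; rewrite addNr. Qed.

HB.instance Definition _ :=
  GRing.isZmodule.Build (fps R) fps_addA fps_addC fps_add0 fps_addN.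

Definition fps_trunc N a : {poly R} := \poly_(i < N) a i.

Fact fps_mul_trunc N a b n : (n < N)%N ->
  fps_mul a b n = (fps_trunc N a * fps_trunc N b)`_n.
Proof.
move=> ltnN; rewrite coefM /=; apply: eq_bigr => i _.
by rewrite !coef_poly (leq_trans (ltn_ord i)) // (leq_ltn_trans (leq_subr _ _)).
Qed.

Fact fps_mulC : commutative fps_mul.
Proof.
by move=> a b; apply/fpsP => n; rewrite !(@fps_mul_trunc n.+1) // mulrC.
Qed.

Fact fps_mulA : associative fps_mul.
Proof.
move=> a b c; apply/fpsP => n.
have trM d e m : (m < n.+1)%N ->
    (fps_trunc n.+1 (fps_mul d e))`_m = (fps_trunc n.+1 d * fps_trunc n.+1 e)`_m.
  by move=> ltm; rewrite coef_poly ltm (@fps_mul_trunc n.+1).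
rewrite !(@fps_mul_trunc n.+1) //.
transitivity ((fps_trunc n.+1 a * (fps_trunc n.+1 b * fps_trunc n.+1 c))`_n).
  by rewrite !coefM; apply: eq_bigr => i _; rewrite trM // ltnS leq_subr.
rewrite mulrA [LHS]coefM [RHS]coefM; apply: eq_bigr => i _.
by rewrite trM // ltn_ord.
Qed.

Fact fps_mul1 : left_id fps_one fps_mul.
Proof.
move=> a; apply/fpsP => n /=; rewrite big_ord_recl /= subn0 mul1r.
by rewrite big1 ?addr0 // => i _; rewrite mul0r.
Qed.

Fact fps_mulDl : left_distributive fps_mul fps_add.
Proof.
move=> a b c; apply/fpsP => n /=; rewrite -big_split /=.
by apply: eq_bigr => i _; rewrite mulrDl.
Qed.

Fact fps_one_neq0 : fps_one != fps_zero.
Proof.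
by apply/eqP => /fpsP/(_ 0%N) /= /eqP; rewrite oner_eq0.
Qed.

HB.instance Definition _ := GRing.Zmodule_isComNzRing.Build (fps R)
  fps_mulA fps_mulC fps_mul1 fps_mulDl fps_one_neq0.

Definition fpsX : fps R := FPS (fun n => (n == 1%N)%:R).

Definition fpsC (c : R) : fps R := FPS (fun n => if n == 0%N then c else 0).

Definition fps_deriv a : fps R := FPS (fun n => a n.+1 *+ n.+1).

(* Composition a(p). The sum is finite, and it is the usual composition,
   provided p has zero constant term; for other p it is a junk value. *)
Definition fps_comp (a p : fps R) : fps R :=
  FPS (fun n => \sum_(k < n.+1) a k * (p ^+ k) n).

End FpsRing.

Arguments fpsX {R}.
Notation "''t'" := fpsX (at level 0) : ring_scope.
Notation "a \of p" := (fps_comp a p) (at level 50, left associativity) : ring_scope.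

Definition fps_map (R S : Type) (f : R -> S) (a : fps R) : fps S :=
  FPS (fun n => f (a n)).

Lemma fps_mapE (R S : Type) (f : R -> S) a n : fps_map f a n = f (a n).
Proof. by []. Qed.

Section FpsTheory.

Variable R : comNzRingType.
Implicit Types (a b c p q : fps R) (n : nat).

Lemma fps0E n : (0 : fps R) n = 0. Proof. by []. Qed.
Lemma fps1E n : (1 : fps R) n = (n == 0%N)%:R. Proof. by []. Qed.
Lemma fpsDE a b n : (a + b) n = a n + b n. Proof. by []. Qed.
Lemma fpsNE a n : (- a) n = - a n. Proof. by []. Qed.
Lemma fpsBE a b n : (a - b) n = a n - b n. Proof. by []. Qed.
Lemma fpsME a b n : (a * b) n = \sum_(i < n.+1) a i * b (n - i)%N.
Proof. by []. Qed.
Lemma fpsM0 a b : (a * b) 0%N = a 0%N * b 0%N.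
Proof. by rewrite fpsME big_ord1. Qed.
Lemma fpsX0 a n : (a ^+ n) 0%N = a 0%N ^+ n.
Proof. by elim: n => [|n IHn] //; rewrite !exprS fpsM0 IHn. Qed.

Lemma fps_sumE I (r : seq I) (P : pred I) (F : I -> fps R) n :
  (\sum_(i <- r | P i) F i) n = \sum_(i <- r | P i) F i n.
Proof. by elim/big_rec2: _ => // i x y _ <-. Qed.

Lemma fps_prod0 I (r : seq I) (P : pred I) (F : I -> fps R) :
  (\prod_(i <- r | P i) F i) 0%N = \prod_(i <- r | P i) F i 0%N.
Proof. by elim/big_rec2: _ => // i x y _ <-; rewrite fpsM0. Qed.

Lemma fpsC_is_zmod_morphism : zmod_morphism (@fpsC R).
Proof.
by move=> x y; apply/fpsP => -[|n]; rewrite fpsBE //= subr0.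
Qed.

Lemma fpsCM (x : R) a n : (fpsC x * a) n = x * a n.
Proof.
rewrite fpsME big_ord_recl /= subn0 big1 ?addr0 // => i _.
by rewrite /= mul0r.
Qed.

Lemma fpsC_is_monoid_morphism : monoid_morphism (@fpsC R).
Proof.
split=> [|x y]; apply/fpsP => n; first by rewrite fps1E; case: n.
by rewrite fpsCM /=; case: ifP; rewrite ?mulr0.
Qed.

HB.instance Definition _ :=
  GRing.isZmodMorphism.Build R (fps R) (@fpsC R) fpsC_is_zmod_morphism.
HB.instance Definition _ :=
  GRing.isMonoidMorphism.Build R (fps R) (@fpsC R) fpsC_is_monoid_morphism.

Lemma fpsXM a n : ('t * a) n = if n is m.+1 then a m else 0.
Proof.
case: n => [|n]; first by rewrite fpsM0 /= mul0r.
rewrite fpsME big_ord_recl /= mul0r add0r big_ord_recl /= mul1r subn1 /=.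
by rewrite big1 ?addr0 // => i _; rewrite /= mul0r.
Qed.

Lemma fpsXI : injective ( *%R ('t : fps R)).
Proof.
by move=> a b /fpsP eq_ab; apply/fpsP => n; have:= eq_ab n.+1; rewrite !fpsXM.
Qed.

(* Agreement below a given order *)
Definition eqfps n a b := forall m, (m < n)%N -> a m = b m.

Lemma eqfpsM n a a' b b' :
  eqfps n a a' -> eqfps n b b' -> eqfps n (a * b) (a' * b').
Proof.
move=> eqa eqb m ltmn; rewrite !fpsME; apply: eq_bigr => i _.
rewrite eqa ?eqb // ?(leq_ltn_trans (leq_subr _ _)) //.
by rewrite (leq_ltn_trans _ ltmn) // -ltnS.
Qed.

Lemma eqfpsX n a a' k : eqfps n a a' -> eqfps n (a ^+ k) (a' ^+ k).
Proof.
by move=> eqa; elim: k => [|k IHk] //; rewrite !exprS; apply: eqfpsM.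
Qed.

Lemma eqfps_comp n a p p' : eqfps n p p' -> eqfps n (a \of p) (a \of p').
Proof.
move=> eqp m ltmn /=; apply: eq_bigr => k _.
by rewrite (eqfpsX k eqp ltmn).
Qed.

Lemma eqfpsXM n a a' : eqfps n a a' -> eqfps n.+1 ('t * a) ('t * a').
Proof. by move=> eqa [|m] ltmn; rewrite !fpsXM // eqa. Qed.

Lemma eqfps_mulz n a b b' :
  a 0%N = 0 -> eqfps n b b' -> eqfps n.+1 (a * b) (a * b').
Proof.
move=> a0 eqb m ltmn; rewrite !fpsME !big_ord_recl a0 !mul0r; congr (_ + _).
apply: eq_bigr => i _; rewrite eqb //= /bump /= add1n.
by case: m i ltmn => [[]//|m] i ltmn; rewrite subSS (leq_ltn_trans (leq_subr _ _)).
Qed.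

Lemma fps_fixpoint (Psi : fps R -> fps R) :
  (forall n a b, eqfps n a b -> eqfps n.+1 (Psi a) (Psi b)) ->
  exists a, Psi a = a.
Proof.
move=> contr.
have itS n : forall m, eqfps n (iter n Psi 0) (iter (m + n)%N Psi 0).
  elim: n => [|n IHn] m //; rewrite addnS !iterS.
  exact: contr (IHn m).
have ita n : eqfps n (FPS (fun n => iter n.+1 Psi 0 n)) (iter n Psi 0).
  move=> m ltmn /=; have := itS m.+1 (n - m.+1)%N m (ltnSn m).
  by rewrite subnK.
exists (FPS (fun n => iter n.+1 Psi 0 n)); apply/fpsP => n.
exact: (contr _ _ _ (ita n) n (ltnSn n)).
Qed.

Lemma fps_expr_small p k n : p 0%N = 0 -> (n < k)%N -> (p ^+ k) n = 0.
Proof.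
move=> p0; elim: k n => // k IHk n ltnk; rewrite exprS fpsME.
rewrite big_ord_recl p0 mul0r add0r big1 // => i _.
rewrite IHk ?mulr0 //= /bump /= add1n; case: n i ltnk => [[]//|n] i ltnk.
by rewrite subSS (leq_ltn_trans (leq_subr _ _)).
Qed.

Lemma fps_comp_poly a p (u : {poly R}) n : p 0%N = 0 ->
  (forall k, (k < n)%N -> u`_k = a k) ->
  eqfps n (a \of p) (map_poly (@fpsC R) u).[p].
Proof.
move=> p0 ua m ltmn; pose N := maxn (size u) m.+1.
rewrite (@horner_coef_wide _ N); last first.
  by rewrite (leq_trans (size_poly _ _)) ?leq_maxl.
rewrite fps_sumE [fps_coef _ _]/= (big_ord_widen N (fun k => a k * (p ^+ k) m));
  last exact: leq_maxr.
rewrite big_mkcond; apply: eq_bigr => k _; rewrite coef_map fpsCM.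
case: ltnP => [lekm|ltmk]; last by rewrite fps_expr_small ?mulr0.
by rewrite ua // (leq_ltn_trans _ ltmn).
Qed.

Lemma trunc_coef n a k : (k < n)%N -> (fps_trunc n a)`_k = a k.
Proof. by move=> ltkn; rewrite coef_poly ltkn. Qed.

Lemma fps_compM a b p : p 0%N = 0 -> (a * b) \of p = (a \of p) * (b \of p).
Proof.
move=> p0; apply/fpsP => n.
have ltn : (n < n.+1)%N by [].
rewrite (eqfpsM (fps_comp_poly p0 (@trunc_coef _ _))
                (fps_comp_poly p0 (@trunc_coef _ _)) ltn).
rewrite -hornerM_comm; last exact: mulrC.
rewrite -rmorphM; apply: (fps_comp_poly p0 _ ltn) => k ltk.
by rewrite fpsME coefM; apply: eq_bigr => i _;
  rewrite !trunc_coef // ?(leq_trans (ltn_ord i)) // (leq_ltn_trans (leq_subr _ _)).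
Qed.

Lemma fps_comp1 p : 1 \of p = 1.
Proof.
apply/fpsP => n /=; rewrite big_ord_recl /= mul1r big1 ?addr0 // => i _.
by rewrite /= mul0r.
Qed.

Lemma fps_compC (x : R) p : fpsC x \of p = fpsC x.
Proof.
apply/fpsP => n; rewrite /= big_ord_recl /= big1 ?addr0 => [|k _].
  by case: n => [|n]; rewrite ?mulr1 ?mulr0.
by rewrite mul0r.
Qed.

Lemma fps_compX a p k : p 0%N = 0 -> (a ^+ k) \of p = (a \of p) ^+ k.
Proof.
move=> p0; elim: k => [|k IHk]; first by rewrite !expr0 fps_comp1.
by rewrite !exprS fps_compM // IHk.
Qed.

Lemma fps_comp_prod I (r : seq I) (P : pred I) (F : I -> fps R) p :
  p 0%N = 0 ->
  (\prod_(i <- r | P i) F i) \of p = \prod_(i <- r | P i) (F i \of p).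
Proof.
move=> p0; elim/big_rec2: _ => [|i x y _ <-]; first exact: fps_comp1.
by rewrite fps_compM.
Qed.

Lemma fps_Xcomp p : p 0%N = 0 -> 't \of p = p.
Proof.
move=> p0; apply/fpsP => -[|n] /=.
  by rewrite big_ord1 mul0r p0.
rewrite big_ord_recl mul0r add0r big_ord_recl /= mul1r expr1.
by rewrite big1 ?addr0 // => i _; rewrite /= mul0r.
Qed.

Lemma fps_exprX k n : (('t : fps R) ^+ k) n = (n == k)%:R.
Proof.
elim: k n => [|k IHk] n; first by rewrite fps1E.
by rewrite exprS fpsXM; case: n => [|n] //; rewrite IHk.
Qed.

Lemma fps_compX' a : a \of 't = a.
Proof.
apply/fpsP => n /=; rewrite big_ord_recr /= fps_exprX eqxx mulr1.
rewrite big1 ?add0r // => i _; rewrite fps_exprX gtn_eqF ?mulr0 //.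
Qed.

Lemma fps_comp0 a p : (a \of p) 0%N = a 0%N.
Proof. by rewrite /= big_ord1 expr0 mulr1. Qed.

Lemma fps_comp_wide a p n N : p 0%N = 0 -> (n < N)%N ->
  (a \of p) n = \sum_(k < N) a k * (p ^+ k) n.
Proof.
move=> p0 ltnN /=; rewrite (big_ord_widen N (fun k => a k * (p ^+ k) n)) //.
rewrite big_mkcond; apply: eq_bigr => k _.
by case: ltnP => // ltnk; rewrite fps_expr_small ?mulr0.
Qed.

Lemma fps_compA a p q : p 0%N = 0 -> q 0%N = 0 ->
  a \of (p \of q) = (a \of p) \of q.
Proof.
move=> p0 q0; apply/fpsP => n; rewrite [LHS]/= [RHS]/=.
have eqR (m : 'I_n.+1) :
    (a \of p) m * (q ^+ m) n
      = \sum_(k < n.+1) a k * ((p ^+ k) m * (q ^+ m) n).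
  rewrite (fps_comp_wide _ p0 (ltn_ord m)) mulr_suml.
  by apply: eq_bigr => k _; rewrite mulrA.
under [RHS]eq_bigr => m _ do rewrite eqR.
rewrite exchange_big; apply: eq_bigr => k _ /=.
by rewrite -mulr_sumr -fps_compX.
Qed.

End FpsTheory.

Section FpsMap.

Variables (R S : comNzRingType) (f : {rmorphism R -> S}).

Lemma fps_map_is_zmod_morphism : zmod_morphism (fps_map f).
Proof. by move=> a b; apply/fpsP => n; rewrite /= rmorphB. Qed.

Lemma fps_map_is_monoid_morphism : monoid_morphism (fps_map f).
Proof.
split=> [|a b]; apply/fpsP => n /=; first by rewrite rmorph_nat.
by rewrite rmorph_sum; apply: eq_bigr => i _; rewrite rmorphM.
Qed.

HB.instance Definition _ :=
  GRing.isZmodMorphism.Build (fps R) (fps S) (fps_map f)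
    fps_map_is_zmod_morphism.
HB.instance Definition _ :=
  GRing.isMonoidMorphism.Build (fps R) (fps S) (fps_map f)
    fps_map_is_monoid_morphism.

Lemma fps_mapX : fps_map f 't = 't.
Proof. by apply/fpsP => n; rewrite /= rmorph_nat. Qed.

Lemma fps_map_comp a p : fps_map f (a \of p) = fps_map f a \of fps_map f p.
Proof.
apply/fpsP => n /=; rewrite rmorph_sum; apply: eq_bigr => k _.
by rewrite rmorphM -rmorphXn.
Qed.

End FpsMap.

Lemma fps_map_inj (K L : fieldType) (f : {rmorphism K -> L}) :
  injective (fps_map f).
Proof.
move=> a b /fpsP eq_ab; apply/fpsP => n.
by have /= /fmorph_inj := eq_ab n.
Qed.

Section FpsField.

Variable K : fieldType.
Implicit Types (a b u : fps K).

Lemma fps_inv_exists a : a 0%N != 0 -> exists b, b * a = 1.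
Proof.
move=> a0; have [b eqb] : exists b,
    fpsC (a 0%N)^-1 * (1 - (a - fpsC (a 0%N)) * b) = b.
  apply: fps_fixpoint => n b c eqbc m ltm; rewrite !fpsCM !fpsBE; congr (_ * (_ - _)).
  by apply: eqfps_mulz eqbc _ ltm; rewrite fpsBE /= subrr.
exists b; have: fpsC (a 0%N) * b = 1 - (a - fpsC (a 0%N)) * b.
  by rewrite -[in LHS]eqb mulrA -rmorphM /= divff // rmorph1 mul1r.
rewrite mulrBl opprB addrCA -[LHS]addr0 => /addrI/esym/eqP.
by rewrite subr_eq0 mulrC => /eqP.
Qed.

Lemma fps_lagrange_exists a : a 0%N != 0 ->
  exists q : fps K, q 0%N = 0 /\ q * (a \of q) = 't.
Proof.
move=> a0; have [b ba1] := fps_inv_exists a0.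
have [q eqq] : exists q : fps K, 't * (b \of q) = q.
  by apply: fps_fixpoint => n p p' eqp; apply/eqfpsXM/eqfps_comp.
have q0 : q 0%N = 0 by rewrite -eqq fpsXM.
exists q; split=> //; rewrite -[X in X * _]eqq -mulrA -fps_compM // ba1.
by rewrite fps_comp1 mulr1.
Qed.

Lemma fps_root_exists u l : l%:R != 0 :> K -> u 0%N = 1 -> exists w : fps K, w ^+ l = u.
Proof.
move=> l0 u0; pose z (w : fps K) : fps K := w - fpsC (w 0%N) + 1.
have z0 w : z w 0%N = 1 by rewrite fpsDE fpsBE subrr add0r.
have Psi0 w : (z w - fpsC l%:R^-1 * (z w ^+ l - u)) 0%N
            = 1 - l%:R^-1 * (1 ^+ l - u 0%N).
  by rewrite fpsBE fpsCM fpsBE fpsX0 z0.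
have [w eqw] : exists w : fps K, z w - fpsC l%:R^-1 * (z w ^+ l - u) = w.
  apply: fps_fixpoint => n a b eqab m; rewrite ltnS => lemn.
  case: m lemn => [|m] lemn.
    exact: etrans (Psi0 a) (esym (Psi0 b)).
  have eqz : eqfps n (z a - z b) 0.
    move=> k ltkn; rewrite /z (eqab 0%N) ?(leq_ltn_trans _ ltkn) //.
    by rewrite !(fpsBE, fpsDE) eqab // subrr.
  apply/eqP; rewrite -subr_eq0 -fpsBE.
  have -> : z a - fpsC l%:R^-1 * (z a ^+ l - u)
              - (z b - fpsC l%:R^-1 * (z b ^+ l - u))
          = (z a - z b) * (1 - fpsC l%:R^-1
              * \sum_(i < l) z a ^+ (l.-1 - i) * z b ^+ i).
    by rewrite [RHS]mulrBr mulr1 [in RHS]mulrCA -subrXX; ring.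
  rewrite mulrC; set e := 1 - _.
  have e0 : e 0%N = 0.
    rewrite fpsBE fpsCM fps_sumE; apply/eqP; rewrite subr_eq0; apply/eqP.
    under eq_bigr => i _ do rewrite fpsM0 !fpsX0 !z0 !expr1n mulr1.
    by rewrite sumr_const card_ord mulVf.
  by rewrite (eqfps_mulz e0 eqz (lemn : (m.+1 < n.+1)%N)) mulr0.
exists w; have w0 : w 0%N = 1.
  by rewrite -eqw Psi0 expr1n u0 subrr mulr0 subr0.
have zw : z w = w by rewrite /z w0 rmorph1 subrK.
move: eqw; rewrite zw -[RHS]subr0 => /addrI/oppr_inj eq0.
apply/eqP; rewrite -subr_eq0 -[_ - u]mul1r.
by rewrite -(rmorph1 (@fpsC K)) -(divff l0) rmorphM /= -mulrA eq0 mulr0.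
Qed.

Lemma irreducible_factor_exists (p : {poly K}) :
  (1 < size p)%N -> exists q, irreducible_poly q /\ q %| p.
Proof.
have [n] := ubnP (size p); elim: n p => // n IHn p leqn p_gt1.
have [irr_p|red_p] := pselect (irreducible_poly p); first by exists p.
have [q [q1 qp ltqp]] : exists q : {poly K}, [/\ size q != 1%N, q %| p & ~~ (q %= p)].
  apply: contrapT => noq; apply: red_p; split=> // q q1 qp.
  by apply: contrapT => /negP nqp; apply: noq; exists q.
have p0 : p != 0 by rewrite -size_poly_gt0 ltnW.
have ltsz : (size q < size p)%N.
  by rewrite ltn_neqAle dvdp_leq // andbT dvdp_size_eqp.
have q0 : q != 0 by apply: contraTneq qp => ->; rewrite dvd0p.
have q_gt1 : (1 < size q)%N by rewrite ltn_neqAle eq_sym q1 size_poly_gt0.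
have [r [irr_r rq]] := IHn q (leq_trans ltsz leqn) q_gt1.
by exists r; split=> //; apply: dvdp_trans rq qp.
Qed.

Lemma root_extension (c : K) l : (0 < l)%N ->
  exists (L : fieldType) (iota : {rmorphism K -> L}) (z : L), z ^+ l = iota c.
Proof.
move=> l0; have [|q [irr_q qp]] := @irreducible_factor_exists ('X^l - c%:P).
  by rewrite size_XnsubC.
have [L _ [z rz _]] := irredp_FAdjoin irr_q.
exists L, (in_alg L), z; apply/eqP; rewrite -subr_eq0.
have : root (map_poly (in_alg L) ('X^l - c%:P)) z.
  by move: qp; rewrite -(dvdp_map (in_alg L)) => /(root_dvdp) /(_ rz).
by rewrite rmorphB /= map_polyXn map_polyC /= rootE !hornerE.
Qed.

End FpsField.

(* K[[t^l]] *)
Definition fps_of_tpow (R : comNzRingType) (l : nat) (a : fps R) : Prop :=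
  exists b, a = b \of 't ^+ l.

(* t K[[t^l]] *)
Definition fps_of_X_tpow (R : comNzRingType) (l : nat) (a : fps R) : Prop :=
  exists2 b, fps_of_tpow l b & a = 't * b.

(* l-multiple Riordan arrays (g; f_1, ..., f_l), the f_i being indexed from 0 *)
Record mriordan (K : fieldType) (l : nat) := MRiordan {
  mr_g : fps K;
  mr_f : 'I_l -> fps K;
  mr_g_tpow : fps_of_tpow l mr_g;
  mr_g0 : mr_g 0%N != 0;
  mr_f_tpow : forall i, fps_of_X_tpow l (mr_f i);
  mr_f1 : forall i, mr_f i 1%N != 0
}.

(* Z is the product of X = (g; f_1, ..., f_l) and Y = (d; h_1, ..., h_l):
   for every l-th root h of f_1 ... f_l, over any extension field L of K,
   Z = (g d(h); (f_i / h) h_i(h)).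
   As h <> 0, the second component can be written without the quotient.
   Such an h exists by mr_root_exists, so that Z is unique. *)
Definition is_mr_mul (K : fieldType) (l : nat) (X Y Z : mriordan K l) : Prop :=
  forall (L : fieldType) (iota : {rmorphism K -> L}) (h : fps L),
    h ^+ l = fps_map iota (\prod_(i < l) mr_f X i) ->
    fps_map iota (mr_g Z) = fps_map iota (mr_g X) * (fps_map iota (mr_g Y) \of h)
    /\ forall i, fps_map iota (mr_f Z i) * h
               = fps_map iota (mr_f X i) * (fps_map iota (mr_f Y i) \of h).

Section MRiordan.

Variables (K : fieldType) (charK : [pchar K] =i pred0).
Variables (l : nat) (l_ge2 : (1 < l)%N).
Implicit Types (X Y Z : mriordan K l) (G D : fps K) (phi eta : 'I_l -> fps K).

Fact l_gt0 : (0 < l)%N. Proof. exact: ltnW. Qed.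

Fact tl0 (R : comNzRingType) : ('t ^+ l : fps R) 0%N = 0.
Proof. by rewrite fpsX0 /= expr0n gtn_eqF ?l_gt0. Qed.

#[local] Hint Resolve l_gt0 tl0 : core.

Lemma mr_eq X Y : mr_g X = mr_g Y -> mr_f X = mr_f Y -> X = Y.
Proof.
case: X Y => [g f a b c d] [g' f' a' b' c' d'] /= eg ef.
by case: g' / eg a' b' => a' b'; case: f' / ef c' d' => c' d'; congr MRiordan.
Qed.

(* X = (G(t^l); t phi_1(t^l), ..., t phi_l(t^l)) *)
Definition mr_core X G phi :=
  [/\ G 0%N != 0, forall i, phi i 0%N != 0, mr_g X = G \of 't ^+ l
    & forall i, mr_f X i = 't * (phi i \of 't ^+ l)].

Lemma mr_coreP X : exists G phi, mr_core X G phi.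
Proof.
have [G defG] := mr_g_tpow X.
have fP i : exists b, mr_f X i = 't * (b \of 't ^+ l).
  by have [_ [b ->] ->] := mr_f_tpow X i; exists b.
exists G, (fun i => projT1 (cid (fP i))); split=> //.
- by have:= mr_g0 X; rewrite defG fps_comp0.
- move=> i; case: cid => b /= defb.
  by have:= mr_f1 X i; rewrite defb fpsXM fps_comp0.
- by move=> i; case: cid.
Qed.

Lemma mr_core_exists G phi : G 0%N != 0 -> (forall i, phi i 0%N != 0) ->
  exists X, mr_core X G phi.
Proof.
move=> G0 phi0.
have g_tpow : fps_of_tpow l (G \of 't ^+ l) by exists G.
have g0 : (G \of 't ^+ l) 0%N != 0 by rewrite fps_comp0.
have f_tpow i : fps_of_X_tpow l ('t * (phi i \of 't ^+ l)).
  by exists (phi i \of 't ^+ l) => //; exists (phi i).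
have f1 i : ('t * (phi i \of 't ^+ l)) 1%N != 0 by rewrite fpsXM fps_comp0.
by exists (MRiordan g_tpow g0 f_tpow f1).
Qed.

Lemma mr_core_inj X Y G phi : mr_core X G phi -> mr_core Y G phi -> X = Y.
Proof.
move=> [_ _ gX fX] [_ _ gY fY]; apply: mr_eq; first by rewrite gX gY.
by apply/funext => i; rewrite fX fY.
Qed.

Lemma mr_core_eq X G G' phi phi' : mr_core X G phi ->
  G = G' -> phi =1 phi' -> mr_core X G' phi'.
Proof. by move=> coreX <- /funext <-. Qed.

(* h^l as a power series in t^l *)
Definition mr_pow phi : fps K := 't * \prod_(i < l) phi i.

Lemma mr_pow0 phi : mr_pow phi 0%N = 0. Proof. by rewrite fpsXM. Qed.

Lemma mr_prodE X G phi : mr_core X G phi ->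
  \prod_(i < l) mr_f X i = mr_pow phi \of 't ^+ l.
Proof.
case=> _ _ _ fX; under eq_bigr => i _ do rewrite fX.
rewrite big_split /= prodr_const card_ord fps_compM // fps_Xcomp //.
by rewrite fps_comp_prod.
Qed.

Lemma mr_root_exists X : exists (L : fieldType) (iota : {rmorphism K -> L})
  (h : fps L), h ^+ l = fps_map iota (\prod_(i < l) mr_f X i) /\
    exists2 w : fps L, h = 't * w & w 0%N != 0.
Proof.
have [G [phi core]] := mr_coreP X; have [_ phi0 _ _] := core.
pose Phi := \prod_(i < l) phi i; pose c := Phi 0%N.
have c0 : c != 0 by rewrite /c fps_prod0; apply/prodf_neq0.
have [w0 wP] : exists w : fps K, w ^+ l = fpsC c^-1 * Phi.
  apply: fps_root_exists; last by rewrite fpsCM mulVf.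
  by rewrite (pcharf0P K).1 // -lt0n.
have [L [iota [z zl]]] := root_extension c l_gt0.
pose w := fpsC z * (fps_map iota w0 \of 't ^+ l).
have mapX : fps_map iota ('t ^+ l) = 't ^+ l by rewrite rmorphXn /= fps_mapX.
have mapC (x : K) : fps_map iota (fpsC x) = fpsC (iota x).
  by apply/fpsP => -[|n] //=; rewrite rmorph0.
have w0_0 : w0 0%N != 0.
  apply: contra_eq_neq (congr1 (fun a : fps K => a 0%N) wP) => w0_0.
  by rewrite fpsX0 w0_0 expr0n gtn_eqF // fpsCM mulVf // eq_sym oner_eq0.
have z0 : z != 0.
  by apply: contra_neq c0 => z0; apply/(fmorph_inj iota);
    rewrite -zl z0 rmorph0 expr0n gtn_eqF.
exists L, iota, ('t * w); split; last first.
  by exists w => //; rewrite fpsCM fps_comp0 mulf_neq0 //= fmorph_eq0.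
rewrite (mr_prodE core) /mr_pow fps_compM // fps_Xcomp // rmorphM /=.
rewrite mapX exprMn; congr (_ * _).
rewrite fps_map_comp mapX exprMn -fps_compX //.
rewrite -[fps_map iota w0 ^+ l]rmorphXn /= wP rmorphM /= mapC.
rewrite -[fpsC z ^+ l]rmorphXn /= zl fps_compM // fps_compC mulrA.
by rewrite -rmorphM -rmorphM divff // !rmorph1 mul1r.
Qed.

Lemma mr_core_is_mul X Y Z G D phi eta :
  mr_core X G phi -> mr_core Y D eta ->
  mr_core Z (G * (D \of mr_pow phi)) (fun i => phi i * (eta i \of mr_pow phi)) ->
  is_mr_mul X Y Z.
Proof.
move=> coreX coreY coreZ L iota h hl.
have [_ _ gX fX] := coreX; have [_ _ gY fY] := coreY; have [_ _ gZ fZ] := coreZ.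
have h0 : h 0%N = 0.
  apply/eqP; have/eqP := congr1 (fun a : fps L => a 0%N) hl.
  by rewrite fpsX0 (mr_prodE coreX) fps_mapE fps_comp0 mr_pow0 rmorph0 expf_eq0 l_gt0.
have mapX : fps_map iota ('t ^+ l) = 't ^+ l by rewrite rmorphXn /= fps_mapX.
have key E : fps_map iota ((E \of mr_pow phi) \of 't ^+ l)
           = fps_map iota (E \of 't ^+ l) \of h.
  rewrite -(fps_compA E (mr_pow0 phi) (tl0 K)) -(mr_prodE coreX) !fps_map_comp.
  by rewrite -hl mapX -(fps_compA _ (tl0 L) h0) (fps_compX 't l h0) (fps_Xcomp h0).
split=> [|i].
  by rewrite gX gY gZ fps_compM // rmorphM /= key.
rewrite fX fY fZ fps_compM // !rmorphM /= key fps_mapX fps_compM //.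
by rewrite fps_Xcomp // -!mulrA; congr (_ * (_ * _)); rewrite mulrC.
Qed.

Lemma mr_mul_core_exists X Y G D phi eta :
  mr_core X G phi -> mr_core Y D eta -> exists Z,
  mr_core Z (G * (D \of mr_pow phi)) (fun i => phi i * (eta i \of mr_pow phi)).
Proof.
move=> [G0 phi0 _ _] [D0 eta0 _ _]; apply: mr_core_exists => [|i].
  by rewrite fpsM0 fps_comp0 mulf_neq0.
by rewrite fpsM0 fps_comp0 mulf_neq0.
Qed.

Lemma mr_mul_exists X Y : exists Z, is_mr_mul X Y Z.
Proof.
have [G [phi coreX]] := mr_coreP X; have [D [eta coreY]] := mr_coreP Y.
have [Z coreZ] := mr_mul_core_exists coreX coreY.
by exists Z; apply: mr_core_is_mul coreZ.
Qed.

Lemma is_mr_mul_uniq X Y Z Z' : is_mr_mul X Y Z -> is_mr_mul X Y Z' -> Z = Z'.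
Proof.
have [L [iota [h [hl [w hw w0]]]]] := mr_root_exists X.
move=> /(_ L iota h hl) [gZ fZ] /(_ L iota h hl) [gZ' fZ'].
apply: mr_eq; first by apply: (@fps_map_inj _ _ iota); rewrite gZ gZ'.
apply/funext => i; apply: (@fps_map_inj _ _ iota).
have := etrans (fZ i) (esym (fZ' i)); rewrite hw ![_ * ('t * _)]mulrCA.
move/fpsXI; have [v vw1] := fps_inv_exists w0.
move/(congr1 ( *%R v)); rewrite ![v * _]mulrCA vw1.
by rewrite !mulr1.
Qed.

Definition mr_mul X Y : mriordan K l := projT1 (cid (mr_mul_exists X Y)).

Lemma mr_mulP X Y : is_mr_mul X Y (mr_mul X Y).
Proof. by rewrite /mr_mul; case: cid. Qed.

Lemma mr_core_mul X Y G D phi eta : mr_core X G phi -> mr_core Y D eta ->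
  mr_core (mr_mul X Y)
    (G * (D \of mr_pow phi)) (fun i => phi i * (eta i \of mr_pow phi)).
Proof.
move=> coreX coreY; have [Z coreZ] := mr_mul_core_exists coreX coreY.
by rewrite (is_mr_mul_uniq (@mr_mulP X Y) (mr_core_is_mul coreX coreY coreZ)).
Qed.

Fact fps1_tpow : fps_of_tpow l (1 : fps K).
Proof. by exists 1; rewrite fps_comp1. Qed.

Fact fpsX_tpow (i : 'I_l) : fps_of_X_tpow l ('t : fps K).
Proof. by exists 1; [exact: fps1_tpow | rewrite mulr1]. Qed.

Definition mr_one : mriordan K l :=
  @MRiordan K l 1 (fun=> 't) fps1_tpow (oner_neq0 K) fpsX_tpow
    (fun=> oner_neq0 K).

Lemma mr_core_one : mr_core mr_one 1 (fun=> 1).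
Proof. by split=> * /=; rewrite ?fps_comp1 ?mulr1 ?oner_neq0. Qed.

Lemma mr_pow_one : mr_pow (fun=> 1) = 't.
Proof. by rewrite /mr_pow big1 ?mulr1. Qed.

Lemma mr_pow_mul phi eta :
  mr_pow (fun i => phi i * (eta i \of mr_pow phi)) = mr_pow eta \of mr_pow phi.
Proof.
rewrite [in RHS]/mr_pow -/(mr_pow phi) fps_compM ?mr_pow0 // fps_Xcomp ?mr_pow0 //.
by rewrite {1}/mr_pow big_split mulrA fps_comp_prod ?mr_pow0.
Qed.

Lemma mr_mulA : associative mr_mul.
Proof.
move=> X Y Z.
have [G [phi coreX]] := mr_coreP X; have [D [eta coreY]] := mr_coreP Y.
have [E [psi coreZ]] := mr_coreP Z.
have core1 := mr_core_mul coreX (mr_core_mul coreY coreZ).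
have core2 := mr_core_mul (mr_core_mul coreX coreY) coreZ.
apply: mr_core_inj core1 (mr_core_eq core2 _ _) => [|i]; rewrite mr_pow_mul.
  rewrite (fps_compM _ _ (mr_pow0 phi)) (fps_compA _ (mr_pow0 eta) (mr_pow0 phi)).
  by rewrite (mulrA G (D \of mr_pow phi)).
rewrite (fps_compM _ _ (mr_pow0 phi)) (fps_compA _ (mr_pow0 eta) (mr_pow0 phi)).
by rewrite (mulrA (phi i) (eta i \of mr_pow phi)).
Qed.

Lemma mr_mul1 : left_id mr_one mr_mul.
Proof.
move=> X; have [G [phi coreX]] := mr_coreP X.
have := mr_core_mul mr_core_one coreX; rewrite mr_pow_one fps_compX' mul1r.
move/mr_core_inj; apply; move: coreX; congr mr_core.
by apply/funext => i; rewrite fps_compX' mul1r.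
Qed.

Lemma mr_mulr1 : right_id mr_one mr_mul.
Proof.
move=> X; have [G [phi coreX]] := mr_coreP X.
have := mr_core_mul coreX mr_core_one; rewrite fps_comp1 mulr1.
move/mr_core_inj; apply; move: coreX; congr mr_core.
by apply/funext => i; rewrite ?fps_comp1 mulr1.
Qed.

Lemma mr_inv_exists X : exists Y, mr_mul Y X = mr_one.
Proof.
have [G [phi coreX]] := mr_coreP X; have [G0 phi0 _ _] := coreX.
have Phi0 : (\prod_(i < l) phi i) 0%N != 0.
  by rewrite fps_prod0; apply/prodf_neq0.
have [q [q0 qPhi]] := fps_lagrange_exists Phi0.
have [|D DG] := @fps_inv_exists _ (G \of q); first by rewrite fps_comp0.
have etaP i : exists b, b * (phi i \of q) = 1.
  by apply: fps_inv_exists; rewrite fps_comp0.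
pose eta i := projT1 (cid (etaP i)).
have etaE i : eta i * (phi i \of q) = 1 by rewrite /eta; case: cid.
have neq0 (a b : fps K) : a * b = 1 -> a 0%N != 0.
  move/(congr1 (fun a : fps K => a 0%N)); rewrite fpsM0 => ab.
  by apply: contra_eq_neq ab => ->; rewrite mul0r eq_sym oner_eq0.
have [Y coreY] := mr_core_exists (neq0 _ _ DG) (fun i => neq0 _ _ (etaE i)).
have powY : mr_pow eta = q.
  rewrite /mr_pow -qPhi fps_comp_prod // -mulrA -big_split /=.
  by rewrite big1 ?mulr1 // => i _; rewrite mulrC etaE.
exists Y; apply: mr_core_inj (mr_core_mul coreY coreX) _.
rewrite powY DG; have := mr_core_one; congr mr_core.
by apply/funext => i; rewrite etaE.
Qed.

Definition mr_inv X : mriordan K l := projT1 (cid (mr_inv_exists X)).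

Lemma mr_mulV : left_inverse mr_one mr_inv mr_mul.
Proof. by move=> X; rewrite /mr_inv; case: cid. Qed.

Lemma mr_mulrV : right_inverse mr_one mr_inv mr_mul.
Proof.
move=> X; suff {1}-> : X = mr_inv (mr_inv X) by exact: mr_mulV.
by rewrite -[LHS]mr_mul1 -(mr_mulV (mr_inv X)) -mr_mulA mr_mulV mr_mulr1.
Qed.

(* The multiple Riordan group; the two hypotheses, under which mr_mul
   is well defined, are carried by the type for the sake of inference. *)
Definition mriordan_group of [pchar K] =i pred0 & (1 < l)%N : Type :=
  mriordan K l.

Local Notation MR := (mriordan_group charK l_ge2).

HB.instance Definition _ := gen_eqMixin MR.
HB.instance Definition _ := gen_choiceMixin MR.
HB.instance Definition _ := isGroup.Build MR
  mr_mulA mr_mul1 mr_mulr1 mr_mulV mr_mulrV.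

Definition mr_appell : {pred MR} :=
  fun X : mriordan K l => `[< forall i, mr_f X i = 't >].

Definition mr_lagrange : {pred MR} :=
  fun X : mriordan K l => `[< mr_g X = 1 >].

Definition mr_derivative : {pred MR} :=
  fun X : mriordan K l =>
    `[< exists h : fps K, [/\ fps_of_X_tpow l h,
          h ^+ l = \prod_(i < l) mr_f X i & mr_g X = fps_deriv h] >].

Definition mr_bell (j : 'I_l) : {pred MR} :=
  fun X : mriordan K l => `[< mr_f X j = 't * mr_g X >].

End MRiordan.

Arguments mr_appell {K} charK {l} l_ge2 _.
Arguments mr_lagrange {K} charK {l} l_ge2 _.
Arguments mr_derivative {K} charK {l} l_ge2 _.
Arguments mr_bell {K} charK {l} l_ge2 j _.

(* Main.v *)
Require Import Defs.
From HB Require Import structures.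
From mathcomp Require Import all_boot all_algebra.
From mathcomp Require Import boolp.

Set Implicit Arguments.
Unset Strict Implicit.
Unset Printing Implicit Defensive.

Import GRing.Theory.
Local Open Scope ring_scope.

(* A subset S containing 1 is a subgroup as soon as y, x y \in S imply x \in S.
   Write x = (G(t^l); t phi_i(t^l)), y = (D(t^l); t eta_i(t^l)) and
   p = t phi_1 ... phi_l, so that x y corresponds to G D(p) and phi_i eta_i(p).
   For three of the subsets the implication is a cancellation. For the
   derivative subset let t w(t^l) and t v(t^l) be the l-th roots attached to y
   and x y; then h = t (v / w(p))(t^l) is an l-th root of p(t^l), and t v(t^l)
   is the composition of t w(t^l) with h, so that the chain rule gives h'. *)

Lemma group_closed_cancel (G : groupType) (S : {pred G}) : (1%g \in S) ->
  (forall x y : G, y \in S -> (x * y)%g \in S -> x \in S) -> group_closed S.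
Proof. by move=> S1 SK; split=> // x y Sx Sy; apply: SK Sy _; rewrite divgK. Qed.

Section FpsComp.

Variable R : comNzRingType.
Implicit Types a b p : fps R.

(** The coefficients involved have index at most [n.+1], so truncating both series at [n.+2] reduces
    the claim to the product rule for polynomials. *)
Lemma fps_derivM a b : fps_deriv (a * b) = fps_deriv a * b + a * fps_deriv b.
Proof.
apply/fpsP => n; set N := n.+2; have ltnN : (n < N)%N by rewrite ltnS ltnW.
have derivE c i : (i <= n)%N -> fps_deriv c i = (fps_trunc N c)^`()`_i.
  by move=> lein; rewrite coef_deriv trunc_coef.
have -> : fps_deriv (a * b) n = (fps_trunc N a * fps_trunc N b)^`()`_n.
  by rewrite coef_deriv -fps_mul_trunc.
rewrite derivM coefD !coefM fpsDE !fpsME; congr (_ + _); apply: eq_bigr => i _.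
  have lein : (i <= n)%N by rewrite -ltnS.
  by rewrite derivE // trunc_coef // ltnS (leq_trans (leq_subr _ _)).
by rewrite derivE ?leq_subr // trunc_coef // (leq_trans (ltn_ord i)).
Qed.

Lemma fps_derivX p k : fps_deriv (p ^+ k.+1) = p ^+ k * fps_deriv p *+ k.+1.
Proof.
elim: k => [|k IHk]; first by rewrite expr1 mul1r.
by rewrite exprS fps_derivM IHk mulrnAr mulrA -exprS mulrC addrC [RHS]mulrSr mulrC.
Qed.

(** Differentiate the sum of the [a k * p ^+ k] term by term: the term [k = 0] is constant and drops
    out, the power rule handles the others. *)
Lemma fps_deriv_comp a p : p 0%N = 0 ->
  fps_deriv (a \of p) = (fps_deriv a \of p) * fps_deriv p.
Proof.
move=> p0; apply/fpsP => n.
transitivity (\sum_(k < n.+1) fps_deriv a k * (p ^+ k * fps_deriv p) n).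
  rewrite [LHS]/= big_ord_recl expr0 fps1E mulr0 add0r -sumrMnl.
  apply: eq_bigr => k _; rewrite lift0.
  rewrite -mulrnAr -[X in _ * X = _]/(fps_deriv (p ^+ k.+1) n) fps_derivX.
  have -> m (c : fps R) : (c *+ m) n = c n *+ m.
    by elim: m => // m IHm; rewrite !mulrS fpsDE IHm.
  by rewrite mulrnAl mulrnAr.
under eq_bigr => k _ do rewrite fpsME mulr_sumr.
rewrite exchange_big fpsME; apply: eq_bigr => i _.
(* The inner sum runs over all [k <= n]; its terms with [k > i] vanish because [p] has no constant
   term. *)
rewrite (fps_comp_wide _ p0 (ltn_ord i)) mulr_suml.
by apply: eq_bigr => k _; rewrite mulrA.
Qed.

(** The coefficient of index [n] of a series reappears at index [l * n] after substituting
    ['t ^+ l]. *)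
Lemma fps_comp_tpow_inj l : (0 < l)%N -> injective (fun a => a \of 't ^+ l).
Proof.
move=> l0 a b /fpsP eq_ab; apply/fpsP => n; have := eq_ab (l * n)%N.
have tl0 : ('t ^+ l : fps R) 0%N = 0 by rewrite fpsX0 expr0n gtn_eqF.
have coefE c : (c \of 't ^+ l) (l * n)%N = c n.
  have ltn : (n < (l * n).+1)%N by rewrite ltnS leq_pmull.
  rewrite [LHS]/= (bigD1 (Ordinal ltn)) //= -exprM fps_exprX eqxx mulr1.
  rewrite big1 ?addr0 // => k neq_kn; rewrite -exprM fps_exprX eqn_pmul2l //.
  by rewrite eq_sym (negPf (neq_kn : (k != n :> nat))) mulr0.
by rewrite !coefE.
Qed.

End FpsComp.

Lemma fps_mulIf (K : fieldType) (c : fps K) : c 0%N != 0 -> injective ( *%R^~ c).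
Proof.
move=> c0 a b /= eq_ab; have [d dc] := fps_inv_exists c0.
by rewrite -[a]mulr1 -[b]mulr1 -dc (mulrC d) !mulrA eq_ab.
Qed.

Section Subgroups.

Variables (K : fieldType) (charK : [pchar K] =i pred0).
Variables (l : nat) (l_ge2 : (1 < l)%N).
Local Notation MR := (mriordan_group charK l_ge2).
Implicit Types (X Y : mriordan K l) (G : fps K) (phi : 'I_l -> fps K).

Let lgt0 : (0 < l)%N := ltnW l_ge2.
Let tpow0 : ('t ^+ l : fps K) 0%N = 0 := tl0 l_ge2 K.
#[local] Hint Resolve lgt0 tpow0 mr_pow0 : core.

Lemma mr_group_closed (S : {pred MR}) : S (mr_one K l) ->
  (forall X Y, S Y -> S (mr_mul l_ge2 X Y) -> S X) -> group_closed S.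
Proof. by move=> S1 SK; apply: group_closed_cancel => [|X Y]; [|exact: SK]. Qed.

(** Cancelling ['t] and the injective substitution of ['t ^+ l] lets membership be read off [G] and
    [phi]; the next three lemmas do the same for the other subsets. *)
Lemma core_appell X G phi : mr_core X G phi ->
  mr_appell charK l_ge2 X = `[< forall i, phi i = 1 >].
Proof.
case=> _ _ _ fX; apply: asbool_equiv_eq; split=> eq1 i; last first.
  by rewrite fX eq1 fps_comp1 mulr1.
apply: (fps_comp_tpow_inj lgt0) => /=; apply: fpsXI.
by rewrite -fX eq1 fps_comp1 mulr1.
Qed.

Lemma core_lagrange X G phi : mr_core X G phi ->
  mr_lagrange charK l_ge2 X = `[< G = 1 >].
Proof.
case=> _ _ gX _; apply: asbool_equiv_eq; split=> eq1; last first.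
  by rewrite gX eq1 fps_comp1.
by apply: (fps_comp_tpow_inj lgt0); rewrite /= -gX eq1 fps_comp1.
Qed.

Lemma core_bell j X G phi : mr_core X G phi ->
  mr_bell charK l_ge2 j X = `[< phi j = G >].
Proof.
case=> _ _ gX fX; apply: asbool_equiv_eq; rewrite gX fX; split=> [/fpsXI|->//].
exact: fps_comp_tpow_inj.
Qed.

Lemma core_derivative X G phi : mr_core X G phi ->
  mr_derivative charK l_ge2 X =
  `[< exists2 w : fps K, w ^+ l = \prod_(i < l) phi i
        & G \of 't ^+ l = fps_deriv ('t * (w \of 't ^+ l)) >].
Proof.
move=> coreX; have [_ _ gX _] := coreX.
have rootE (w : fps K) : ('t * (w \of 't ^+ l)) ^+ l = \prod_(i < l) mr_f X i <->
    w ^+ l = \prod_(i < l) phi i.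
  rewrite (mr_prodE l_ge2 coreX) exprMn -fps_compX // /mr_pow fps_compM //.
  rewrite fps_Xcomp //; split=> [|-> //].
  (* Both sides carry a factor ['t ^+ l], to be cancelled before the substitution. *)
  have tlI n : injective ( *%R ('t ^+ n : fps K)).
    by elim: n => [|n IHn] a b; rewrite ?mul1r // exprS -!mulrA => /fpsXI/IHn.
  by move=> /tlI; apply: fps_comp_tpow_inj.
apply: asbool_equiv_eq; rewrite -gX; split=> [[h [[_ [w ->] ->] /rootE]]|[w]].
  by exists w.
exists ('t * (w \of 't ^+ l)); split=> //; last exact/rootE.
by exists (w \of 't ^+ l) => //; exists w.
Qed.

Lemma appell_closed : group_closed (mr_appell charK l_ge2).
Proof.
apply: mr_group_closed => [|X Y]; first exact/asboolP.
have [G [phi coreX]] := mr_coreP X; have [D [eta coreY]] := mr_coreP Y.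
rewrite (core_appell coreX) (core_appell coreY).
rewrite (core_appell (mr_core_mul charK l_ge2 coreX coreY)).
move=> /asboolP eta1 /asboolP phi_eta; apply/asboolP => i.
by rewrite -(phi_eta i) eta1 fps_comp1 mulr1.
Qed.

Lemma lagrange_closed : group_closed (mr_lagrange charK l_ge2).
Proof.
apply: mr_group_closed => [|X Y]; first exact/asboolP.
have [G [phi coreX]] := mr_coreP X; have [D [eta coreY]] := mr_coreP Y.
rewrite (core_lagrange coreX) (core_lagrange coreY).
rewrite (core_lagrange (mr_core_mul charK l_ge2 coreX coreY)).
by move=> /asboolP-> /asboolP GD; apply/asboolP; rewrite -GD fps_comp1 mulr1.
Qed.

Lemma bell_closed j : group_closed (mr_bell charK l_ge2 j).
Proof.
apply: mr_group_closed => [|X Y]; first by apply/asboolP; rewrite /= mulr1.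
have [G [phi coreX]] := mr_coreP X; have [D [eta coreY]] := mr_coreP Y.
rewrite (core_bell _ coreX) (core_bell _ coreY).
rewrite (core_bell _ (mr_core_mul charK l_ge2 coreX coreY)).
(* Both hypotheses together give [phi j * D(p) = G * D(p)], where [D(p)] has nonzero constant
   term. *)
move=> /asboolP-> /asboolP phiD; apply/asboolP; apply: fps_mulIf phiD.
by rewrite fps_comp0; case: coreY.
Qed.

Lemma derivative_closed : group_closed (mr_derivative charK l_ge2).
Proof.
apply: mr_group_closed => [|X Y].
  rewrite (core_derivative (mr_core_one K l)); apply/asboolP.
  (* For the identity array the root is [h = 't], with derivative 1. *)
  exists 1; first by rewrite expr1n big1.
  by rewrite !fps_comp1 mulr1; apply/fpsP => -[|n] //=; rewrite mul0rn.
have [G [phi coreX]] := mr_coreP X; have [D [eta coreY]] := mr_coreP Y.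
have [[_ phi0 _ _] [D0 eta0 _ _]] := (coreX, coreY).
rewrite (core_derivative coreX) (core_derivative coreY).
rewrite (core_derivative (mr_core_mul charK l_ge2 coreX coreY)).
set p := mr_pow phi; have p0 : p 0%N = 0 by exact: mr_pow0.
move=> /asboolP[w wl Dw] /asboolP[v vl GDv].
have prod0 (psi : 'I_l -> fps K) : (forall i, psi i 0%N != 0) ->
    (\prod_(i < l) psi i) 0%N != 0.
  by move=> psi0; rewrite fps_prod0; apply/prodf_neq0.
have w0 : w 0%N != 0.
  by apply: contraNneq (prod0 _ eta0) => w0; rewrite -wl fpsX0 w0 expr0n gtn_eqF.
have [|z zw] := @fps_inv_exists _ (w \of p); first by rewrite fps_comp0.
pose x := v * z; have xw : x * (w \of p) = v by rewrite -mulrA zw mulr1.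
have xl : x ^+ l = \prod_(i < l) phi i.
  (* The factor cancelled is [w(p) ^+ l]; multiplying by it turns [x ^+ l] into [v ^+ l]. *)
  apply: (@fps_mulIf _ ((\prod_(i < l) eta i) \of p)) => [|/=].
    by rewrite fps_comp0 prod0.
  by rewrite -wl fps_compX // -exprMn xw vl big_split /= -fps_comp_prod // -wl fps_compX.
apply/asboolP; exists x => //; pose h := 't * (x \of 't ^+ l).
have h0 : h 0%N = 0 by rewrite fpsXM.
have hl : h ^+ l = p \of 't ^+ l.
  by rewrite exprMn -fps_compX // xl /p /mr_pow fps_compM // fps_Xcomp.
(* A series in ['t ^+ l] sees [h] only through [h ^+ l], which is [p] at ['t ^+ l]. *)
have comp_h a : (a \of 't ^+ l) \of h = (a \of p) \of 't ^+ l.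
  by rewrite -(fps_compA _ tpow0 h0) (fps_compX _ _ h0) (fps_Xcomp h0) hl fps_compA.
(* After multiplication by this factor, the left side is the derivative of ['t * v('t ^+ l)], and
   the right side is the chain rule for ['t * w('t ^+ l)] composed with [h]. *)
apply: (@fps_mulIf _ ((D \of p) \of 't ^+ l)) => [|/=].
  by rewrite !fps_comp0.
rewrite -fps_compM // GDv -comp_h Dw [RHS]mulrC -(fps_deriv_comp _ h0); congr fps_deriv.
by rewrite (fps_compM _ _ h0) (fps_Xcomp h0) comp_h -mulrA -fps_compM // xw.
Qed.

End Subgroups.

Theorem proposition2p1 (K : fieldType) (charK : [pchar K] =i pred0)
    (l : nat) (l_ge2 : (1 < l)%N) :
  [/\ group_closed (mr_appell charK l_ge2),
      group_closed (mr_lagrange charK l_ge2),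
      group_closed (mr_derivative charK l_ge2)
    & forall j : 'I_l, group_closed (mr_bell charK l_ge2 j)].
Proof.
split; [exact: appell_closed | exact: lagrange_closed |
        exact: derivative_closed | exact: bell_closed].
Qed.
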